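(* Let $b<0<a$ be real numbers such that $a/b$ is irrational, and let $I\subset\mathbb{R}$ be a nonempty open interval of finite length $|I|$. Let $S$ be the semigroup of translations generated by $(a,I)$ and $(b,I)$. Let $\langle x,y\rangle$ be the free nonunitary semigroup on $x,y$, and let $d:\langle x,y\rangle\to\mathbb{R}$ be defined by $d(x)=a$, $d(y)=b$ and $d(uv)=d(u)+d(v)$ for all $u,v\in\langle x,y\rangle$. Let $\mathbb{J}$ be the ideal of $\langle x,y\rangle$ generated by all words $xz$ and $yz$ with $z\in\langle x,y\rangle$ such that $|d(z)|>|I|$. Then $S$ is a homomorphic image of the Rees factor semigroup $\langle x,y\rangle/\mathbb{J}$.
   Context: For $f\in\mathbb{R}$ and an open interval $J\subset\mathbb{R}$ (possibly empty), $(f,J)$ denotes the partial transformation of the real line $t\mapsto t+f$ defined for $t\in J$; all $(f,\emptyset)$ are identified with a single zero element $0$. Composition is $(f,J)\circ(g,J')=(f+g,(J-g)\cap J')$, where $J-g=\{t-g\mid t\in J\}$. The semigroup operation on $S$ is this composition. The free nonunitary semigroup consists of all nonempty finite words under concatenation. If $\mathbb{J}$ is an ideal of a free semigroup $F$, the Rees factor $F/\mathbb{J}$ is the semigroup $(F\setminus\mathbb{J})\cup\{0\}$ in which all elements of $\mathbb{J}$ are identified with $0$. *)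

(* Defs.v *)
From HB Require Import structures.
From mathcomp Require Import all_boot all_order all_algebra.
From mathcomp Require Import all_classical all_reals.

Set Implicit Arguments.
Unset Strict Implicit.
Unset Printing Implicit Defensive.

Import Order.TTheory GRing.Theory Num.Theory.

Local Open Scope classical_set_scope.
Local Open Scope ring_scope.

Section Semigroups.
Variable G : semigroupType.

Definition is_subsemigroup (A : set G) : Prop :=
  forall u v, A u -> A v -> A (u * v)%g.

Definition is_ideal (A : set G) : Prop :=
  forall u v, A u -> A (u * v)%g /\ A (v * u)%g.

Record ideal := Ideal { ideal_set :> set G; idealP : is_ideal ideal_set }.

Lemma ideal_generated_subproof (A : set G) : is_ideal (smallest is_ideal A).
Proof.
by move=> u v Au; split=> B [/[dup] idB /(_ u v) + AB] => -[]//; apply: Au.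
Qed.

Definition ideal_generated (A : set G) : ideal :=
  Ideal (@ideal_generated_subproof A).

Definition subsemigroup_generated (A : set G) : Type :=
  {u : G | u \in smallest is_subsemigroup A}.

Lemma subsemigroup_generated_closed (A : set G) :
  mulg_closed (fun u => u \in smallest is_subsemigroup A).
Proof.
move=> u v; rewrite [u \in _]inE [v \in _]inE [(u * v)%g \in _]unfold_in => Au Av.
apply/mem_set => B [sB AB].
by apply: (sB); [apply: (set_mem Au) | apply: (set_mem Av)].
Qed.

HB.instance Definition _ (A : set G) := SubChoice.on (subsemigroup_generated A).
HB.instance Definition _ (A : set G) :=
  SubChoice_isSubSemigroup.Build G _ (subsemigroup_generated A)
    (@subsemigroup_generated_closed A).

Variable J : ideal.

(* [None] is the zero into which all the elements of [J] are collapsed. *)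
Definition rees_factor : Type := option {u : G | u \notin (J : set G)}.

HB.instance Definition _ := Choice.on rees_factor.

Definition rees_mul (p q : rees_factor) : rees_factor :=
  match p, q with
  | Some u, Some v => insub (val u * val v)%g
  | _, _ => None
  end.

Lemma rees_mulA : associative rees_mul.
Proof.
have Jl u v : v \in (J : set G) -> (u * v)%g \in (J : set G).
  by move=> /set_mem/idealP => /(_ u)[_ ?]; apply/mem_set.
have Jr u v : u \in (J : set G) -> (u * v)%g \in (J : set G).
  by move=> /set_mem/idealP => /(_ v)[? _]; apply/mem_set.
move=> [u|] [v|] [w|] //=; try by case: insubP.
case: (insubP _ (val v * val w)%g) => [vw _ evw|/negPn Jvw];
  case: (insubP _ (val u * val v)%g) => [uv _ euv|/negPn Juv] //=.
- by rewrite evw euv mulgA.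
- by rewrite evw insubN// negbK mulgA Jr.
- by rewrite euv insubN// negbK -mulgA Jl.
Qed.

HB.instance Definition _ := hasMul.Build rees_factor rees_mul.
HB.instance Definition _ := Magma_isSemigroup.Build rees_factor rees_mulA.

End Semigroups.

Definition homomorphic_image (H G : semigroupType) : Prop :=
  exists f : {multiplicative G -> H}, range f = [set: H].

Section FreeSemigroup.
Variable A : choiceType.

Definition free_semigroup : Type := {w : seq A | w != [::]}.

HB.instance Definition _ := SubChoice.on free_semigroup.

Lemma free_mul_subproof (u v : free_semigroup) : val u ++ val v != [::].
Proof. by case: u => [[]]. Qed.

Definition free_mul (u v : free_semigroup) : free_semigroup :=
  exist _ (val u ++ val v) (free_mul_subproof u v).

Lemma free_mulA : associative free_mul.
Proof. by move=> u v w; apply/val_inj; rewrite /= catA. Qed.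

HB.instance Definition _ := hasMul.Build free_semigroup free_mul.
HB.instance Definition _ := Magma_isSemigroup.Build free_semigroup free_mulA.

Definition free_gen (a : A) : free_semigroup := exist _ [:: a] isT.

End FreeSemigroup.

Section PartialTransformations.
Variable T : Type.

Definition partial_transf : Type := T -> option T.

HB.instance Definition _ := gen_eqMixin partial_transf.
HB.instance Definition _ := gen_choiceMixin partial_transf.

(* [q] acts first. *)
Definition partial_comp (p q : partial_transf) : partial_transf :=
  fun t => obind p (q t).

Lemma partial_compA : associative partial_comp.
Proof. by move=> p q r; apply/funext => t; rewrite /partial_comp; case: (r t). Qed.

HB.instance Definition _ := hasMul.Build partial_transf partial_comp.
HB.instance Definition _ :=
  Magma_isSemigroup.Build partial_transf partial_compA.

Lemma partial_mulE (p q : partial_transf) t : (p * q)%g t = obind p (q t).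
Proof. by []. Qed.

End PartialTransformations.

Section PartialTranslations.
Variable R : realType.

(* The partial transformation (f, J). *)
Definition ptranslation (f : R) (J : set R) : partial_transf R :=
  fun t => if t \in J then Some (t + f) else None.

Lemma ptranslationM (f g : R) (J J' : set R) :
  (ptranslation f J * ptranslation g J')%g =
  ptranslation (f + g) ([set t - g | t in J] `&` J').
Proof.
have mem_shift t : (t \in [set s - g | s in J]) = (t + g \in J).
  apply/idP/idP => /set_mem H; apply/mem_set.
    by case: H => s Js <-; rewrite subrK.
  by exists (t + g) => //; rewrite addrK.
apply/funext => t; rewrite partial_mulE /ptranslation in_setI mem_shift andbC.
case: ifP => //= _; case: ifP => // _.
by rewrite -addrA [g + f]addrC.
Qed.

(* Two pairs name the same element exactly when they are equal or when both
   intervals are empty. *)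
Lemma ptranslation_eq (f g : R) (J J' : set R) :
  ptranslation f J = ptranslation g J' <-> J = J' /\ (J = set0 \/ f = g).
Proof.
split=> [e|[<- [->|->//]]]; last first.
  by apply/funext => t; rewrite /ptranslation in_set0.
have eJ : J = J'.
  apply/seteqP; split=> t Jt; move: (congr1 (@^~ t) e);
  by rewrite /ptranslation (mem_set Jt); case: ifP => // /set_mem.
split=> //; rewrite -{}eJ in e.
have [->|/set0P[t Jt]] := eqVneq J set0; [by left|right].
move: (congr1 (@^~ t) e); rewrite /ptranslation (mem_set Jt).
by case=> /addrI.
Qed.

End PartialTranslations.

(* Main.v *)
Require Import Defs.
From HB Require Import structures.
From mathcomp Require Import all_boot all_order all_algebra.
From mathcomp Require Import all_classical all_reals.
From mathcomp Require Import lra.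

(** Sending x, y to (a, I), (b, I) extends to a surjective homomorphism from
    the free semigroup onto S. If the image of a word cz, c a letter, is
    defined at t, then z already acts at t, so t and t + d z both lie in I and
    |d z| < |I|. Hence the generators of J, and therefore all of J, go to the
    empty transformation. As J is nonempty (it contains x^(n+1) as soon as
    n a > |I|), the empty transformation is in S and is the image of the zero
    of the Rees factor. *)

Import Order.TTheory GRing.Theory Num.Theory.

Local Open Scope classical_set_scope.
Local Open Scope ring_scope.

Section FreeSemigroupTheory.
Variable A : choiceType.

Lemma free_semigroup_ind (P : free_semigroup A -> Prop) :
  (forall c, P (free_gen c)) -> (forall c u, P u -> P (free_gen c * u)%g) ->
  forall u, P u.
Proof.
move=> P1 PM [[//|c w] w0]; elim: w c w0 => [|c' w IHw] c w0.
  by rewrite [exist _ _ _](_ : _ = free_gen c)//; apply/val_inj.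
rewrite [exist _ _ _](_ : _ = free_gen c * exist _ (c' :: w) isT)%g; last first.
  exact/val_inj.
exact/PM/IHw.
Qed.

Section Lift.
Variables (G : semigroupType) (g : A -> G).

(** A nonempty word is passed as its first letter and its tail: a semigroup has no unit that could
    serve as the value at the empty word. *)
Fixpoint word_lift (c : A) (w : seq A) : G :=
  if w is c' :: w' then (g c * word_lift c' w')%g else g c.

Lemma word_lift_cat c w c' w' :
  word_lift c (w ++ c' :: w') = (word_lift c w * word_lift c' w')%g.
Proof. by elim: w c => [//|c'' w IHw] c /=; rewrite IHw mulgA. Qed.

Definition free_lift (u : free_semigroup A) : G :=
  match val u as w return w != [::] -> G with
  | [::] => fun w0 => False_rect G (negP w0 isT)
  | c :: w => fun=> word_lift c w
  end (valP u).

Lemma free_liftM : {morph free_lift : u v / (u * v)%g}.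
Proof. by move=> [[//|c w] ?] [[//|c' w'] ?]; apply: word_lift_cat. Qed.

HB.instance Definition _ :=
  isMultiplicative.Build (free_semigroup A) G free_lift free_liftM.

End Lift.
End FreeSemigroupTheory.

(** The image of [P] in [G] is a subsemigroup containing [A], hence contains the smallest one. With
    [P] the range of a homomorphism this yields surjectivity. *)
Lemma subsemigroup_generated_setT (G : semigroupType) (A : set G)
    (P : set (subsemigroup_generated A)) :
  is_subsemigroup P -> (forall s, A (val s) -> P s) -> P = [set: _].
Proof.
move=> PM PA; apply/seteqP; split=> // s _.
suff [s' Ps' /val_inj <-] : (val @` P) (val s) by [].
apply: (set_mem (valP s)); split=> [_ _ [u Pu <-] [v Pv <-]|u Au].
  by exists (u * v)%g; [exact: PM | exact: valM].
have sgu : u \in smallest (@is_subsemigroup G) A.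
  by apply/mem_set => B [_]; apply.
by exists (exist _ u sgu) => //; apply: PA.
Qed.

(** Since [J] is an ideal on which [f] is constant, the value [f u0] absorbs every [f u]; sending
    [None] to it therefore respects products. *)
Lemma homomorphic_image_rees_factor (G H : semigroupType)
    (f : {multiplicative G -> H}) (J : ideal G) (u0 : G) :
  range f = [set: H] -> (J : set G) u0 ->
  (forall u, (J : set G) u -> f u = f u0) ->
  homomorphic_image H (rees_factor J).
Proof.
move=> fsurj Ju0 fJ.
have zl u : (f u0 * f u)%g = f u0.
  by rewrite -gmulfM; apply: fJ; have [] := @idealP _ J u0 u Ju0.
have zr u : (f u * f u0)%g = f u0.
  by rewrite -gmulfM; apply: fJ; have [] := @idealP _ J u0 u Ju0.
pose h (p : rees_factor J) : H := if p is Some u then f (val u) else f u0.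
have hM : {morph h : p q / (p * q)%g}.
  move=> p q; change (h (rees_mul p q) = h p * h q)%g.
  case: p q => [u|] [v|] /=; rewrite ?zl ?zr// -gmulfM.
  (* If the product falls into [J], the Rees product is [None], and [f] takes the value [f u0] there
     as well. *)
  case: (insubP _ (val u * val v)%g) => [w _ <-//|].
  by move=> /negPn/set_mem/fJ ->.
pose hmul := isMultiplicative.Build (rees_factor J) H h hM.
pose hmor : {multiplicative rees_factor J -> H} := HB.pack h hmul.
exists hmor; apply/seteqP; split=> // s _.
have [u _ <-] : range f s by rewrite fsurj.
have [Ju|nJu] := boolP (u \in (J : set G)).
  by exists None => //=; rewrite fJ//; apply: set_mem.
by exists (Some (exist _ u nJu)).
Qed.

Section Displacement.
Variables (R : realType) (A : choiceType) (I : set R).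
Variables (f : free_semigroup A -> partial_transf R) (d : free_semigroup A -> R).
Hypothesis fM : {morph f : u v / (u * v)%g}.
Hypothesis dM : forall u v, d (u * v)%g = d u + d v.
Hypothesis f_gen : forall c, f (free_gen c) = ptranslation (d (free_gen c)) I.

(** The last letter of the word acts first and tests [t] against [I]; every letter then adds its own
    displacement. *)
Lemma displacement u t s : f u t = Some s -> I t /\ s = t + d u.
Proof.
have gen c t' s' : f (free_gen c) t' = Some s' -> I t' /\ s' = t' + d (free_gen c).
  by rewrite f_gen /ptranslation; case: ifP => // /set_mem It [<-].
elim/free_semigroup_ind: u t s => // c u IHu t s.
rewrite fM partial_mulE; case E : (f u t) => [t'|//] /gen[_ ->].
by have [It ->] := IHu _ _ E; rewrite dM -addrA [d u + _]addrC.
Qed.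

(** The extra letter [c] is what tests the endpoint [t + d u] of [u] against [I]. *)
Lemma undefined_gen_mul c u :
  (forall t, I t -> ~ I (t + d u)) -> f (free_gen c * u)%g = fun=> None.
Proof.
move=> dis; apply/funext => t; rewrite fM partial_mulE.
case E : (f u t) => [t'|//] /=; have [It ->] := displacement _ _ _ E.
by rewrite f_gen /ptranslation; case: ifP => // /set_mem /(dis _ It).
Qed.

End Displacement.

Lemma itv_shift_disjoint (R : realType) (l r e : R) : r - l < `|e| ->
  forall t, `]l, r[%classic t -> ~ `]l, r[%classic (t + e).
Proof.
move=> le_e t; rewrite /= !in_itv /= => /andP[lt tr] /andP[lte ter].
suff : `|e| < r - l by rewrite ltNge (ltW le_e).
by rewrite ltr_norml; apply/andP; split; lra.
Qed.

Lemma free_semigroup_unbounded (R : realType) (A : choiceType)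
    (d : free_semigroup A -> R) (c : A) (m : R) :
  (forall u v, d (u * v)%g = d u + d v) -> 0 < d (free_gen c) ->
  exists u, m < d u.
Proof.
move=> dM dc.
have pow n : exists u, d u = d (free_gen c) *+ n.+1.
  elim: n => [|n [u du]]; first by exists (free_gen c).
  by exists (free_gen c * u)%g; rewrite dM du -mulrS.
(* Truncation [n] of the quotient satisfies quotient < n + 1, which is exactly the exponent in
   [pow n]; a negative quotient truncates to 0. *)
have [u du] := pow (Num.truncn (m / d (free_gen c))).
exists u; rewrite du -mulr_natl -ltr_pdivrMr//.
exact: truncnS_gt.
Qed.

Theorem proposition2 (R : realType) (a b : R) (hb : b < 0) (ha : 0 < a)
    (hab : irrational (a / b))
    (l r : R) (hlr : l < r)
    (d : free_semigroup bool -> R)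
    (hdx : d (free_gen true) = a) (hdy : d (free_gen false) = b)
    (hdM : forall u v : free_semigroup bool, d (u * v)%g = d u + d v) :
  let x : free_semigroup bool := free_gen true in
  let y : free_semigroup bool := free_gen false in
  let I : set R := `]l, r[%classic in
  let S := subsemigroup_generated [set ptranslation a I; ptranslation b I] in
  let J := ideal_generated
    [set w : free_semigroup bool | exists z : free_semigroup bool,
       r - l < `|d z| /\ (w = (x * z)%g \/ w = (y * z)%g)] in
  homomorphic_image S (rees_factor J).
Proof.
move=> x y I S J.
pose T := [set ptranslation a I; ptranslation b I].
have Tmem p : T p -> {s : S | val s = p}.
  move=> Tp.
  have sTp : p \in smallest (@is_subsemigroup (partial_transf R)) T.
    by apply/mem_set => B [_]; apply.
  by exists (exist _ p sTp).
have Tgen (c : bool) : T (if c then ptranslation a I else ptranslation b I).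
  by case: c; [left | right].
pose g c : S := sval (Tmem _ (Tgen c)).
pose f : {multiplicative free_semigroup bool -> S} := free_lift _ _ g.
have f_gen c : val (f (free_gen c)) = ptranslation (d (free_gen c)) I.
  by rewrite [LHS](svalP (Tmem _ (Tgen c))); case: c; rewrite ?hdx ?hdy.
have vfM : {morph (fun u => val (f u)) : u v / (u * v)%g}.
  by move=> u v; rewrite gmulfM; exact: valM.
have fJ u : (J : set _) u -> val (f u) = fun=> None.
  (* [J] is the smallest ideal containing its generators, so it suffices that the words with nowhere
     defined image form an ideal containing them. *)
  move=> /(_ [set w | val (f w) = fun=> None]); apply.
  split=> [v w /= fv0|w [z [dz ezw]]].
    rewrite /= !vfM /= fv0; split; apply/funext => t; rewrite partial_mulE//.
    by case: (_ t).
  rewrite /=; have [-> | ->] := ezw;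
    by apply: (undefined_gen_mul _ _ _ _ _ vfM hdM f_gen); apply: itv_shift_disjoint.
have dx0 : 0 < d (free_gen true) by rewrite hdx.
have [z dz] := free_semigroup_unbounded _ _ d true (r - l) hdM dx0.
have Jxz : (J : set _) (x * z)%g.
  move=> B [_]; apply; exists z; split; last by left.
  exact: lt_le_trans dz (ler_norm _).
apply: (homomorphic_image_rees_factor _ _ f J _ _ Jxz) => [|u Ju]; last first.
  by apply/val_inj; rewrite !fJ.
(* Surjectivity: the range of [f] is closed under products and contains both generators, as images
   of [x] and [y]. *)
apply: subsemigroup_generated_setT => [_ _ [u _ <-] [v _ <-]|s Ts].
  by exists (u * v)%g => //; rewrite gmulfM.
by case: Ts => es; [exists x | exists y] => //; apply/val_inj;
  rewrite es f_gen ?hdx ?hdy.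
Qed.
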